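(* Let $f_{3,+},f_{6,-}\in\mathbb{Q}[x_1,x_2,x_3]$ be the polynomials $$f_{3,+}(x)=-(-x_1+x_2+x_3)(x_1-x_2+x_3)(x_1+x_2-x_3),\qquad f_{6,-}(x)=x_1x_2x_3(x_1-x_2)(x_2-x_3)(x_3-x_1).$$ Then: (1) When $l$ is odd, every polynomial in $\mathcal{H}_l^\Gamma$ is divisible by $f_{3,+}$. (2) For every $l$, every polynomial in $\mathcal{H}_{l,-}^\Gamma$ is divisible by $f_{6,-}$.
   Context: Let $D=\mathbb{Q}+\mathbb{Q}i+\mathbb{Q}j+\mathbb{Q}ij$ be the quaternion algebra over $\mathbb{Q}$ with $i^2=j^2=-1$, $ij=-ji$, with involution $\iota(a_0+a_1i+a_2j+a_3ij)=a_0-a_1i-a_2j-a_3ij$, $\mathrm{Tr}(x)=x+\iota(x)$, $\mathrm{Nm}(x)=x\,\iota(x)$. Let $\mathcal{O}=\mathbb{Z}+\mathbb{Z}i+\mathbb{Z}j+\mathbb{Z}w$ with $w=(1+i+j+ij)/2$ (the Hurwitz maximal order). Let $V_D=\{x\in D\mid \mathrm{Tr}(x)=0\}$, with basis $\mathbf{b}_1=-i+j+ij$, $\mathbf{b}_2=i-j+ij$, $\mathbf{b}_3=i+j-ij$; identify $x_1\mathbf{b}_1+x_2\mathbf{b}_2+x_3\mathbf{b}_3\in V_D$ with the row vector $x=(x_1,x_2,x_3)$. For $g\in D^\times$ let $\mathcal{F}(g)\in\mathrm{SL}_3(\mathbb{Q})$ be the matrix such that the map $x\mapsto g^{-1}xg$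 on $V_D$ is $x\mapsto x\,\mathcal{F}(g)$ on row vectors. Put $\Gamma=\mathcal{F}(\mathcal{O}^\times)$, a finite group of order $12$. For $l\ge 0$ let $\mathcal{A}_l$ be the $\mathbb{Q}$-space of homogeneous polynomials of degree $l$ in $\mathbb{Q}[x_1,x_2,x_3]$ (including $0$), let $\Delta_Q=\frac12\left(\frac{\partial^2}{\partial x_1^2}+\frac{\partial^2}{\partial x_2^2}+\frac{\partial^2}{\partial x_3^2}+\frac{\partial^2}{\partial x_1\partial x_2}+\frac{\partial^2}{\partial x_2\partial x_3}+\frac{\partial^2}{\partial x_3\partial x_1}\right)$, let $\mathcal{H}_l=\{f\in\mathcal{A}_l\mid\Delta_Qf=0\}$, and let $\mathcal{H}_l^\Gamma=\{f\in\mathcal{H}_l\mid f(x\gamma)=f(x)\ \forall\gamma\in\Gamma\}$. Let $\mathfrak{T}_2=\{\mathcal{F}(y)\mid y\in\mathcal{O},\ \mathrm{Nm}(y)=2\}$ and define $T_2$ on $\mathcal{H}_l^\Gamma$ by $(T_2f)(x)=\sum_{\gamma\in\Gamma\backslash\mathfrak{T}_2}f(x\gamma^{-1})$. Set $\mathcal{H}_{l,-}^\Gamma=\{f\in\mathcal{H}_l^\Gamma\mid T_2f=-(-1)^lf\}$. Divisibility is in the polynomial ring $\mathbb{Q}[x_1,x_2,x_3]$. *)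

(* Defs.v *)
From HB Require Import structures.
From mathcomp Require Import all_boot all_order all_algebra.
From mathcomp Require Import mpoly ring lra zify.
From Stdlib Require Import ClassicalEpsilon.

Set Implicit Arguments.
Unset Strict Implicit.
Unset Printing Implicit Defensive.

Import Order.TTheory GRing.Theory Num.Theory.
Local Open Scope ring_scope.

(* [Quat a0 a1 a2 a3] is a0 + a1 i + a2 j + a3 ij; multiplication is determined
   by i^2 = j^2 = -1 and ij = -ji. *)
Record quat := Quat { q0 : rat; q1 : rat; q2 : rat; q3 : rat }.

Definition quat_tuple (x : quat) := (q0 x, q1 x, q2 x, q3 x).
Definition tuple_quat (t : rat * rat * rat * rat) :=
  let: (a, b, c, d) := t in Quat a b c d.
Lemma quat_tupleK : cancel quat_tuple tuple_quat. Proof. by case. Qed.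
HB.instance Definition _ := Choice.copy quat (can_type quat_tupleK).

Definition quat_add x y :=
  Quat (q0 x + q0 y) (q1 x + q1 y) (q2 x + q2 y) (q3 x + q3 y).
Definition quat_opp x := Quat (- q0 x) (- q1 x) (- q2 x) (- q3 x).
Definition quat_mul x y :=
  Quat (q0 x * q0 y - q1 x * q1 y - q2 x * q2 y - q3 x * q3 y)
       (q0 x * q1 y + q1 x * q0 y + q2 x * q3 y - q3 x * q2 y)
       (q0 x * q2 y + q2 x * q0 y + q3 x * q1 y - q1 x * q3 y)
       (q0 x * q3 y + q3 x * q0 y + q1 x * q2 y - q2 x * q1 y).
Definition quat_scale a x := Quat (a * q0 x) (a * q1 x) (a * q2 x) (a * q3 x).

Lemma quat_eq x y :
  q0 x = q0 y -> q1 x = q1 y -> q2 x = q2 y -> q3 x = q3 y -> x = y.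
Proof. by case: x => a b c d; case: y => a' b' c' d' /= -> -> -> ->. Qed.

Fact quat_addA : associative quat_add.
Proof. by move=> x y z; apply: quat_eq => /=; ring. Qed.
Fact quat_addC : commutative quat_add.
Proof. by move=> x y; apply: quat_eq => /=; ring. Qed.
Fact quat_add0 : left_id (Quat 0 0 0 0) quat_add.
Proof. by move=> x; apply: quat_eq => /=; ring. Qed.
Fact quat_addN : left_inverse (Quat 0 0 0 0) quat_opp quat_add.
Proof. by move=> x; apply: quat_eq => /=; ring. Qed.
HB.instance Definition _ :=
  GRing.isZmodule.Build quat quat_addA quat_addC quat_add0 quat_addN.

Fact quat_mulA : associative quat_mul.
Proof. by move=> x y z; apply: quat_eq => /=; ring. Qed.
Fact quat_mul1l : left_id (Quat 1 0 0 0) quat_mul.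
Proof. by move=> x; apply: quat_eq => /=; ring. Qed.
Fact quat_mul1r : right_id (Quat 1 0 0 0) quat_mul.
Proof. by move=> x; apply: quat_eq => /=; ring. Qed.
Fact quat_mulDl : left_distributive quat_mul +%R.
Proof. by move=> x y z; apply: quat_eq => /=; ring. Qed.
Fact quat_mulDr : right_distributive quat_mul +%R.
Proof. by move=> x y z; apply: quat_eq => /=; ring. Qed.
Fact quat_1neq0 : Quat 1 0 0 0 != 0.
Proof. by apply/eqP => -[]. Qed.
HB.instance Definition _ := GRing.Zmodule_isNzRing.Build quat
  quat_mulA quat_mul1l quat_mul1r quat_mulDl quat_mulDr quat_1neq0.

Fact quat_scaleA a b v : quat_scale a (quat_scale b v) = quat_scale (a * b) v.
Proof. by apply: quat_eq => /=; ring. Qed.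
Fact quat_scale1 : left_id 1 quat_scale.
Proof. by move=> x; apply: quat_eq => /=; ring. Qed.
Fact quat_scaleDr : right_distributive quat_scale +%R.
Proof. by move=> a x y; apply: quat_eq => /=; ring. Qed.
Fact quat_scaleDl v : {morph quat_scale^~ v : a b / a + b}.
Proof. by move=> a b; apply: quat_eq => /=; ring. Qed.
HB.instance Definition _ := GRing.Zmodule_isLmodule.Build rat quat
  quat_scaleA quat_scale1 quat_scaleDr quat_scaleDl.

Fact quat_scaleAl (a : rat) (u v : quat) : a *: (u * v) = (a *: u) * v.
Proof. by apply: quat_eq => /=; ring. Qed.
HB.instance Definition _ := GRing.Lmodule_isLalgebra.Build rat quat quat_scaleAl.
Fact quat_scaleAr (a : rat) (u v : quat) : a *: (u * v) = u * (a *: v).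
Proof. by apply: quat_eq => /=; ring. Qed.
HB.instance Definition _ := GRing.Lalgebra_isAlgebra.Build rat quat quat_scaleAr.

Definition qi : quat := Quat 0 1 0 0.
Definition qj : quat := Quat 0 0 1 0.
Definition qw : quat := (2%:R : rat)^-1 *: (1 + qi + qj + qi * qj).

Definition qconj (x : quat) : quat := Quat (q0 x) (- q1 x) (- q2 x) (- q3 x).
Definition Tr (x : quat) : quat := x + qconj x.
Definition Nm (x : quat) : quat := x * qconj x.

Lemma quatE (x : quat) :
  x = q0 x *: 1 + q1 x *: qi + q2 x *: qj + q3 x *: (qi * qj).
Proof. by apply: quat_eq => /=; ring. Qed.

Definition sqn (x : quat) : rat := q0 x ^+ 2 + q1 x ^+ 2 + q2 x ^+ 2 + q3 x ^+ 2.

Lemma NmE x : Nm x = (sqn x)%:A.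
Proof. by apply: quat_eq; rewrite /= /sqn; ring. Qed.

Lemma sqn_eq0 x : sqn x = 0 -> x = 0.
Proof.
case: x => a b c d; rewrite /sqn /= => h.
have sq0 (u : rat) : u ^+ 2 = 0 -> u = 0 by move/eqP; rewrite sqrf_eq0 => /eqP.
have [] := (sqr_ge0 a, sqr_ge0 b, sqr_ge0 c, sqr_ge0 d) => -[[ha hb] hc] hd.
by apply: quat_eq => /=; apply: sq0; lra.
Qed.

Definition quat_inv (x : quat) : quat := (sqn x)^-1 *: qconj x.
Definition quat_unit : pred quat := fun x => x != 0.

Lemma sqn_unit x : x != 0 -> sqn x != 0.
Proof. by apply: contraNN => /eqP /sqn_eq0 ->. Qed.

Fact quat_mulVx : {in quat_unit, left_inverse 1 quat_inv *%R}.
Proof.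
move=> x /sqn_unit nz; rewrite /quat_inv -scalerAl.
have -> : qconj x * x = (sqn x)%:A by apply: quat_eq; rewrite /= /sqn; ring.
by rewrite scalerA mulVf // scale1r.
Qed.
Fact quat_mulxV : {in quat_unit, right_inverse 1 quat_inv *%R}.
Proof.
move=> x /sqn_unit nz; rewrite /quat_inv -scalerAr -/(Nm x) NmE.
by rewrite scalerA mulVf // scale1r.
Qed.
Fact quat_unitP (x y : quat) : y * x = 1 /\ x * y = 1 -> quat_unit x.
Proof.
case=> + _; apply: contra_eqN => /eqP ->.
by rewrite mulr0 eq_sym oner_neq0.
Qed.
Fact quat_invr_out : {in [predC quat_unit], quat_inv =1 id}.
Proof. by move=> x /negPn/eqP ->; apply: quat_eq => /=; ring. Qed.
HB.instance Definition _ := GRing.NzRing_hasMulInverse.Build quat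
  quat_mulVx quat_mulxV quat_unitP quat_invr_out.

Definition hurwitz (x : quat) : Prop :=
  exists a b c d : int, x = a%:~R + b%:~R * qi + c%:~R * qj + d%:~R * qw.

Definition hurwitz_unit (u : quat) : Prop :=
  [/\ u \is a GRing.unit, hurwitz u & hurwitz u^-1].

Definition qb1 : quat := - qi + qj + qi * qj.
Definition qb2 : quat := qi - qj + qi * qj.
Definition qb3 : quat := qi + qj - qi * qj.

Definition i1 : 'I_3 := @Ordinal 3 0 isT.
Definition i2 : 'I_3 := @Ordinal 3 1 isT.
Definition i3 : 'I_3 := @Ordinal 3 2 isT.

Definition quat_of_row (x : 'rV[rat]_3) : quat :=
  x 0 i1 *: qb1 + x 0 i2 *: qb2 + x 0 i3 *: qb3.

(* Inverse of [quat_of_row] on the trace-zero quaternions. *)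
Definition row_of_quat (v : quat) : 'rV[rat]_3 :=
  \row_k nth 0 [:: (q2 v + q3 v) / 2%:R; (q1 v + q3 v) / 2%:R;
                   (q1 v + q2 v) / 2%:R] k.

(* Row k holds the coordinates of g^-1 b_k g; see [FconjE] and [F_uniq]. *)
Definition F (g : quat) : 'M[rat]_3 :=
  \matrix_k row_of_quat (g^-1 * nth 0 [:: qb1; qb2; qb3] k * g).

Lemma row_of_quatK (v : quat) : Tr v = 0 -> quat_of_row (row_of_quat v) = v.
Proof.
move=> /(congr1 q0) /= h; have v0 : q0 v = 0 by lra.
by apply: quat_eq; rewrite /= !mxE /= ?v0; field.
Qed.

Lemma quat_of_rowK : cancel quat_of_row row_of_quat.
Proof.
move=> x; apply/rowP => k; rewrite mxE /=.
have [->|->|->] : [\/ k = i1, k = i2 | k = i3].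
- by case: k => [[|[|[]]]] // hk; [apply: Or31|apply: Or32|apply: Or33]; apply: val_inj.
- by rewrite /=; field.
- by rewrite /=; field.
- by rewrite /=; field.
Qed.

Lemma Tr_quat_of_row x : Tr (quat_of_row x) = 0.
Proof. by apply: quat_eq => /=; ring. Qed.

Lemma Tr_conj g v : Tr v = 0 -> Tr (g^-1 * v * g) = 0.
Proof.
move=> h; have v0 : q0 v = 0 by move/(congr1 q0): h => /= h; lra.
by apply: quat_eq; rewrite /GRing.inv /= ?v0; ring.
Qed.

Lemma sum3 (V : nmodType) (G : 'I_3 -> V) : \sum_i G i = G i1 + G i2 + G i3.
Proof.
rewrite !big_ord_recl big_ord0 addr0 addrA.
by congr (G _ + G _ + G _); apply: val_inj.
Qed.

Lemma row_of_quat_linear a u v :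
  row_of_quat (a *: u + v) = a *: row_of_quat u + row_of_quat v.
Proof. by apply/rowP => -[[|[|[|//]]] hk]; rewrite !mxE /=; field. Qed.

Lemma FconjE g (x : 'rV[rat]_3) :
  quat_of_row (x *m F g) = g^-1 * quat_of_row x * g.
Proof.
rewrite -[RHS]row_of_quatK; last exact/Tr_conj/Tr_quat_of_row.
congr quat_of_row; rewrite mulmx_sum_row sum3 !rowK /=.
have -> : g^-1 * quat_of_row x * g = x 0 i1 *: (g^-1 * qb1 * g)
    + (x 0 i2 *: (g^-1 * qb2 * g) + (x 0 i3 *: (g^-1 * qb3 * g) + 0)).
  rewrite /quat_of_row; move: qb1 qb2 qb3 => b1 b2 b3.
  by rewrite !(mulrDl, mulrDr) -!scalerAr -!scalerAl addr0 addrA.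
rewrite !row_of_quat_linear.
have -> : row_of_quat 0 = 0 by apply/rowP => -[[|[|[|//]]] hk]; rewrite !mxE /=; field.
by rewrite addr0 addrA.
Qed.

Lemma F_uniq g (M : 'M[rat]_3) :
  (forall x, quat_of_row (x *m M) = g^-1 * quat_of_row x * g) -> M = F g.
Proof.
move=> h; apply/row_matrixP => k; rewrite !rowE.
by apply: (can_inj quat_of_rowK); rewrite h FconjE.
Qed.

Lemma FM g h : g \is a GRing.unit -> h \is a GRing.unit -> F (g * h) = F g *m F h.
Proof.
move=> ug uh; apply/esym/F_uniq => x.
by rewrite mulmxA !FconjE invrM // !mulrA.
Qed.

Definition Gamma (M : 'M[rat]_3) : Prop := exists2 u, hurwitz_unit u & M = F u.

Definition TT2 (M : 'M[rat]_3) : Prop :=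
  exists y, [/\ hurwitz y, Nm y = 2%:R & M = F y].

Definition same_coset (g h : 'M[rat]_3) : Prop :=
  exists2 d, Gamma d & h = d *m g.

(* A list with exactly one element in each coset of Gamma \ TT2. *)
Definition is_transversal (s : seq 'M[rat]_3) : Prop :=
  [/\ uniq s, forall g, g \in s -> TT2 g
    & forall h, TT2 h -> exists! g, g \in s /\ same_coset g h].

Notation pol := {mpoly rat[3]}.

(* f(x M) for the row vector x = (x_1, x_2, x_3). *)
Definition psubst (f : pol) (M : 'M[rat]_3) : pol :=
  f \mPo [tuple \sum_j M j i *: 'X_j | i < 3].

Lemma psubstE f M (x : 'rV[rat]_3) :
  (psubst f M).@[x 0] = f.@[(x *m M) 0].
Proof.
rewrite comp_mpoly_meval; apply: meval_eq => i.
rewrite tnth_map tnth_ord_tuple mxE raddf_sum /=; apply: eq_bigr => j _.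
by rewrite mevalZ mevalXU mulrC.
Qed.

Definition T2sum (s : seq 'M[rat]_3) (f : pol) : pol :=
  \sum_(g <- s) psubst f (invmx g).

Lemma hurwitzP x : hurwitz x <-> exists a b c d : int,
  [/\ q0 x = a%:~R + d%:~R / 2%:R, q1 x = b%:~R + d%:~R / 2%:R,
      q2 x = c%:~R + d%:~R / 2%:R & q3 x = d%:~R / 2%:R].
Proof.
have intE (n : int) : (n%:~R : quat) = Quat n%:~R 0 0 0.
  by rewrite -(scaler_int n (1 : quat)); apply: quat_eq => /=; ring.
split=> -[a [b [c [d h]]]]; exists a, b, c, d.
  by rewrite h !intE /=; split; field.
by case: h => h0 h1 h2 h3; apply: quat_eq; rewrite ?h0 ?h1 ?h2 ?h3 !intE /=; field.
Qed.

Lemma int_parity (n : int) : exists m : int, n = m + m \/ n = m + m + 1.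
Proof. by exists (n %/ 2)%Z; lia. Qed.

Lemma norm2_parity (a b c d : int) :
  a * a + b * b + c * c + (a + b + c) * d + d * d = 2 ->
  exists e f : int, d = e + e /\ a + b + c = f + f.
Proof.
have [[a' ha] [b' hb]] := (int_parity a, int_parity b).
have [[c' hc] [d' hd]] := (int_parity c, int_parity d).
by case: ha => ->; case: hb => ->; case: hc => ->; case: hd => -> h;
  (exfalso; lia) || (exists d'; eexists; split; [lia|];
   (instantiate (1 := a' + b' + c'); lia) || (instantiate (1 := a' + b' + c' + 1); lia)).
Qed.

Lemma hurwitz_norm2 y : hurwitz y -> Nm y = 2%:R ->
  exists2 u, hurwitz_unit u & y = u * (1 + qi).
Proof.
move=> /hurwitzP [a [b [c [d [h0 h1 h2 h3]]]]].
rewrite NmE => /(congr1 q0) /=; rewrite /sqn h0 h1 h2 h3 => hn.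
have hZ : a * a + b * b + c * c + (a + b + c) * d + d * d = 2 :> int.
  apply: (@intr_inj rat); rewrite !rmorphD /= !rmorphM /= !rmorphD /=.
  by move: hn => /=; lra.
have [e [f [hd hf]]] := norm2_parity hZ.
have [u hu [u0 u1]] : exists2 u, u = y * (2%:R^-1 *: (1 - qi)) &
    hurwitz u /\ sqn u = 1.
  exists (y * (2%:R^-1 *: (1 - qi))) => //; split.
    apply/hurwitzP; exists (f - c), (f - a - c - e), (- e), (c + e + e).
    have ha : a%:~R = f%:~R + f%:~R - b%:~R - c%:~R :> rat.
      by rewrite -!(rmorphD, rmorphB) /=; congr _%:~R; lia.
    by split; rewrite /= h0 h1 h2 h3 hd !(rmorphD, rmorphN, rmorphB) /= ha; field.
  by move: hn; rewrite -h0 -h1 -h2 -h3 /sqn /=; lra.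
have uV : u^-1 = qconj u by rewrite /GRing.inv /= /quat_inv u1 invr1 scale1r.
exists u; last first.
  have e1 : 2%:R^-1 *: (1 - qi) * (1 + qi) = 1 by apply: quat_eq => /=; field.
  by rewrite hu -mulrA e1 mulr1.
split.
- by rewrite unfold_in /=; apply: contra_eqN u1 => /eqP ->.
- exact: u0.
rewrite uV; move/hurwitzP: u0 => [p [q [r [t [E0 E1 E2 E3]]]]].
apply/hurwitzP; exists (p + t), (- q), (- r), (- t).
by split; rewrite /= ?E0 ?E1 ?E2 ?E3 ?(rmorphD, rmorphN) /=; field.
Qed.

Lemma unit_1qi : 1 + qi \is a GRing.unit.
Proof. by apply/eqP => /(congr1 q0). Qed.

Lemma TT2_1qi : TT2 (F (1 + qi)).
Proof.
exists (1 + qi); split=> //.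
by apply/hurwitzP; exists 1, 1, 0, 0; split=> /=; field.
Qed.

Lemma TT2_coset h : TT2 h -> same_coset (F (1 + qi)) h.
Proof.
move=> [y [hy ny ->]]; have [u hu ->] := hurwitz_norm2 hy ny.
exists (F u); first by exists u.
by case: hu => uu _ _; rewrite FM // unit_1qi.
Qed.

Lemma ex_transversal : exists s, is_transversal s.
Proof.
exists [:: F (1 + qi)]; split=> //.
  by move=> g; rewrite inE => /eqP ->; exact: TT2_1qi.
move=> h /TT2_coset hh; exists (F (1 + qi)); split; first by rewrite inE.
by move=> g []; rewrite inE => /eqP ->.
Qed.

(* The representatives are arbitrary; by [T2E] the choice does not matter on
   Gamma-invariant polynomials. *)
Definition T2_reps : seq 'M[rat]_3 :=
  proj1_sig (constructive_indefinite_description _ ex_transversal).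

Definition T2 (f : pol) : pol := T2sum T2_reps f.

Lemma psubst_mul f M N : psubst (psubst f M) N = psubst f (N *m M).
Proof.
rewrite /psubst !(comp_mpolyEX f) raddf_sum /=; apply: eq_bigr => m _.
rewrite !comp_mpolyZ; congr (_ *: _); rewrite !comp_mpolyX rmorph_prod /=.
apply: eq_bigr => i _; rewrite rmorphXn /=; congr (_ ^+ _).
rewrite !tnth_map !tnth_ord_tuple raddf_sum /=.
under eq_bigr => j _ do
  rewrite comp_mpolyZ comp_mpolyXU -tnth_nth tnth_map tnth_ord_tuple scaler_sumr.
rewrite exchange_big /=; apply: eq_bigr => k _.
rewrite mxE scaler_suml; apply: eq_bigr => j _.
by rewrite scalerA mulrC.
Qed.

Lemma F_unit g : g \is a GRing.unit -> F g \in unitmx.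
Proof.
move=> ug; suff /mulmx1_unit [] : F g *m F g^-1 = 1%:M by [].
rewrite -FM ?unitrV // divrr //; apply/esym/F_uniq => x.
by rewrite mulmx1 invr1 mul1r mulr1.
Qed.

Lemma TT2_unit h : TT2 h -> h \in unitmx.
Proof.
move=> /TT2_coset [_ [u [uu _ _] ->] ->].
by rewrite unitmx_mul !F_unit ?unit_1qi.
Qed.

Lemma Gamma_inv M : Gamma M -> Gamma (invmx M).
Proof.
move=> [u [uu hu hv] ->]; exists u^-1; first by split; rewrite ?unitrV ?invrK.
have e : F u *m F u^-1 = 1%:M.
  rewrite -FM ?unitrV // divrr //; apply/esym/F_uniq => x.
  by rewrite mulmx1 invr1 mul1r mulr1.
by rewrite -[LHS]mulmx1 -e mulKmx // F_unit.
Qed.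

Lemma T2E s f : is_transversal s -> (forall M, Gamma M -> psubst f M = f) ->
  T2 f = T2sum s f.
Proof.
suff key s' : is_transversal s' -> (forall M, Gamma M -> psubst f M = f) ->
    T2sum s' f = psubst f (invmx (F (1 + qi))).
  move=> hs hf; rewrite (key s) // /T2 key //.
  by rewrite /T2_reps; case: constructive_indefinite_description.
move=> [us hT hs] hf.
have sub g : TT2 g -> same_coset g (F (1 + qi)).
  move=> /[dup] Tg /TT2_coset [d Gd e]; exists (invmx d); first exact: Gamma_inv.
  rewrite e mulKmx //; move: (TT2_unit Tg).
  by rewrite e unitmx_mul => /andP [].
have [g0 [[g0s [d Gd e]] g0u]] := hs _ TT2_1qi.
have s1 : perm_eq s' [:: g0].
  apply: uniq_perm => // g; rewrite inE; apply/idP/eqP => [gs|-> //].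
  by apply/esym/g0u; split=> //; apply/sub/hT.
rewrite /T2sum (perm_big _ s1) big_seq1 e.
have [ud ug] : d \in unitmx /\ g0 \in unitmx.
  by apply/andP; rewrite -unitmx_mul -e F_unit ?unit_1qi.
have -> : invmx (d *m g0) = invmx g0 *m invmx d.
  rewrite -[LHS]mul1mx -(mulVmx ug) -[in LHS](mulmx1 (invmx g0)) -(mulVmx ud).
  by rewrite -!mulmxA [d *m (g0 *m _)]mulmxA mulmxV ?mulmx1 // unitmx_mul ud.
by rewrite -psubst_mul [psubst f (invmx d)]hf //; apply: Gamma_inv.
Qed.

Definition DeltaQ (f : pol) : pol :=
  (2%:R : rat)^-1 *: (f^`M(i1)^`M(i1) + f^`M(i2)^`M(i2) + f^`M(i3)^`M(i3)
    + f^`M(i2)^`M(i1) + f^`M(i3)^`M(i2) + f^`M(i1)^`M(i3)).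

Definition HH (l : nat) (f : pol) : Prop := f \is l.-homog /\ DeltaQ f = 0.

Definition HGamma (l : nat) (f : pol) : Prop :=
  HH l f /\ forall M, Gamma M -> psubst f M = f.

Definition HGamma_minus (l : nat) (f : pol) : Prop :=
  HGamma l f /\ T2 f = - (- 1) ^+ l *: f.

Definition divides (p f : pol) : Prop := exists r, f = r * p.

Definition f3plus : pol :=
  - ((- 'X_i1 + 'X_i2 + 'X_i3) * ('X_i1 - 'X_i2 + 'X_i3) * ('X_i1 + 'X_i2 - 'X_i3)).

Definition f6minus : pol :=
  'X_i1 * 'X_i2 * 'X_i3 * ('X_i1 - 'X_i2) * ('X_i2 - 'X_i3) * ('X_i3 - 'X_i1).

(* Main.v *)
(** In the coordinates v = (v1, v2, v3) of V_D on i, j, ij, a trace-zero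
    quaternion y gives the half-turn F(y) about y, so -F(y) is the reflection
    in the plane orthogonal to y. If a polynomial f changes sign under this
    reflection, it vanishes on the plane and the linear form <v, y> divides f;
    forms of pairwise non-proportional y are coprime, so their product divides f.
    For l odd, f in H_l^Gamma changes sign under -F(y) for y = i, j, ij, whose
    forms are the factors of f_{3,+}. For f in H_{l,-}^Gamma, since T_2 is the
    action of a single coset, f changes sign under -F(y) for every y of norm 2
    in O; the six y = i +- j, i +- ij, j +- ij give the factors of f_{6,-}. *)
Require Import Defs.
From HB Require Import structures.
From mathcomp Require Import all_boot all_order all_algebra.
From mathcomp Require Import mpoly ring.
Import GRing.Theory.
Local Open Scope ring_scope.

(** * Linear substitutions and division by linear forms *)

Lemma divides_scale (s : rat) (p f : {mpoly rat[3]}) :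
  s != 0 -> divides p f -> divides (s *: p) f.
Proof.
move=> s0 [r ->]; exists (s^-1 *: r).
by rewrite -scalerAl -scalerAr scalerA mulVf ?scale1r.
Qed.

Lemma psubstM (f g : {mpoly rat[3]}) (M : 'M[rat]_3) :
  psubst (f * g) M = psubst f M * psubst g M.
Proof. by rewrite /psubst rmorphM. Qed.

Lemma psubst1 (f : {mpoly rat[3]}) : psubst f 1%:M = f.
Proof.
rewrite -[RHS]comp_mpoly_id /psubst; congr (_ \mPo _).
apply: eq_from_tnth => i; rewrite !tnth_mktuple (bigD1 i) //= big1 => [|j ji].
  by rewrite addr0 mxE eqxx scale1r.
by rewrite mxE (negPf ji) scale0r.
Qed.

Lemma psubst_opp {l : nat} {f : {mpoly rat[3]}} (M : 'M[rat]_3) :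
  f \is l.-homog -> psubst f (- M) = (- 1) ^+ l *: psubst f M.
Proof.
move=> /dhomogP hf; rewrite /psubst !comp_mpolyEX scaler_sumr.
apply: eq_big_seq => m /hf hm.
rewrite scalerA mulrC -scalerA; congr (_ *: _).
rewrite !comp_mpolyX -(hm : mdeg m = l) mdegE -mulr_algl.
have -> : (((- 1) ^+ (\sum_i m i))%:A : {mpoly rat[3]}) = \prod_i (- 1) ^+ m i.
  by rewrite -expr_sum -in_algE rmorphXn rmorphN1.
rewrite -big_split; apply: eq_bigr => i _ /=; rewrite -exprMn !tnth_mktuple.
congr (_ ^+ _); rewrite mulN1r -sumrN; apply: eq_bigr => j _.
by rewrite mxE scaleNr.
Qed.

Definition linform (c : 'cV[rat]_3) : {mpoly rat[3]} := \sum_j c j 0 *: 'X_j.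

(** Modulo [linform c] the substitution fixes every variable: the difference for ['X_i] is the
    constant [b 0 i] times [linform c]. The polynomials with this property contain the constants and
    are closed under sums and products. *)
Lemma divides_sub_psubst (c : 'cV[rat]_3) (b : 'rV[rat]_3) (f : {mpoly rat[3]}) :
  divides (linform c) (f - psubst f (1%:M - c *m b)).
Proof.
set P : 'M[rat]_3 := 1%:M - _; pose D (p : {mpoly rat[3]}) := divides (linform c) (p - psubst p P).
have D1 (s : rat) : D s%:MP.
  by exists 0; rewrite mul0r /psubst comp_mpolyC subrr.
have DD p q : D p -> D q -> D (p + q).
  move=> [r rE] [s sE]; exists (r + s); rewrite mulrDl -rE -sE /psubst rmorphD /=.
  by rewrite opprD addrACA.
have DM p q : D p -> D q -> D (p * q).
  move=> [r rE] [s sE]; exists (r * q + psubst p P * s).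
  rewrite psubstM mulrDl -mulrA [q * _]mulrC mulrA -rE -[_ * s * _]mulrA -sE.
  by rewrite mulrBl mulrBr addrA subrK.
have DX i : D 'X_i.
  exists (b 0 i)%:MP; rewrite /psubst comp_mpolyXU -tnth_nth tnth_mktuple.
  rewrite -[X in X - _]psubst1 /psubst comp_mpolyXU -tnth_nth tnth_mktuple.
  rewrite -sumrB /linform mulr_sumr; apply: eq_bigr => j _.
  rewrite -scalerBl mul_mpolyC scalerA; congr (_ *: _).
  by rewrite !mxE big_ord1; ring.
rewrite -/(D f) (mpolyE f); apply: big_ind => [||m _]; [|exact: DD|].
  by rewrite -mpolyC0; apply: D1.
rewrite -mul_mpolyC; apply: (DM _ _ (D1 _)); rewrite mpolyXE_id.
apply: big_ind => [||i _]; [|exact: DM|].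
  by rewrite -mpolyC1; apply: D1.
elim: (m i) => [|n IH]; first by rewrite expr0 -mpolyC1; apply: D1.
by rewrite exprS; apply: DM.
Qed.

(* P is the projection to the hyperplane x c = 0 along a, so that f o P = 0 and
   the cofactor r of g in f satisfies (r o P) (g o P) = 0. *)
Lemma divides_reflection (c : 'cV[rat]_3) (a : 'rV[rat]_3) (f g : {mpoly rat[3]}) :
    a *m c = 2%:R%:M -> psubst f (1%:M - c *m a) = - f -> divides g f ->
    (exists2 x : 'rV[rat]_3, x *m c = 0 & g.@[x 0] != 0) ->
  divides (linform c * g) f.
Proof.
move=> ac fM [r fE] [x xc gx].
pose P : 'M_3 := 1%:M - c *m (2%:R^-1 *: a).
have PM : P *m (1%:M - c *m a) = P.
  rewrite mulmxBr mulmx1 /P mulmxBl mul1mx -!scalemxAr -scalemxAl.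
  rewrite -mulmxA [a *m _]mulmxA ac mul_scalar_mx -scalemxAr scalerA.
  by rewrite mulVf // scale1r subrr subr0.
have fP : psubst f P = 0.
  have: psubst f P = - psubst f P.
    by rewrite -[in LHS]PM -psubst_mul fM /psubst rmorphN.
  move/eqP; rewrite -addr_eq0 -mulr2n -scaler_nat scaler_eq0 /=.
  by move/eqP.
have gP : psubst g P != 0.
  apply: contraNneq gx => /(congr1 (meval (x 0))).
  by rewrite psubstE meval0 mulmxBr mulmx1 mulmxA xc mul0mx subr0 => ->.
have rP : psubst r P = 0.
  by move/eqP: fP; rewrite fE psubstM mulf_eq0 (negPf gP) orbF => /eqP.
have [s sE] := divides_sub_psubst c (2%:R^-1 *: a) r.
by exists s; rewrite mulrA -sE -/P rP subr0.
Qed.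

(** * Half-turns and mirrors of trace-zero quaternions *)

(* For y = y1 i + y2 j + y3 ij, the column of scalar products <b_k, y>. *)
Definition pairing (y : quat) : 'cV[rat]_3 :=
  \col_k nth 0 [:: - q1 y + q2 y + q3 y; q1 y - q2 y + q3 y;
                   q1 y + q2 y - q3 y] k.

Lemma row_of_quat_pairing y :
  q0 y = 0 -> row_of_quat y *m pairing y = (sqn y)%:M.
Proof.
move=> y0; apply/matrixP => k j; rewrite !ord1 !mxE sum3 !mxE /= /sqn y0.
by field.
Qed.

Lemma quat_of_rowB (t : rat) (r u : 'rV[rat]_3) :
  quat_of_row (t *: r - u) = t *: quat_of_row r - quat_of_row u.
Proof.
rewrite /quat_of_row; move: qb1 qb2 qb3 => b1 b2 b3.
rewrite !mxE !scalerBl !scalerDr !scalerA !opprD.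
by rewrite [X in X + _ = _]addrACA [LHS]addrACA.
Qed.

(** For trace-zero u and y, u y + y u = -2 <u, y> and y^2 = - [sqn y]. Hence y ((2 <u, y> / [sqn y])
    y - u) = u y, so conjugation by y is the half-turn u -> (2 <u, y> / [sqn y]) y - u. *)
Lemma opp_half_turn y : q0 y = 0 -> y != 0 ->
  - F y = 1%:M - pairing y *m ((2%:R / sqn y) *: row_of_quat y).
Proof.
move=> y0 uy; have ny := sqn_unit uy; have yu : y \is a GRing.unit := uy.
set a := _ *: _; rewrite -[RHS]opprB; congr (- _); apply/esym/F_uniq => u.
have yy : y * y = - (sqn y)%:A by apply: quat_eq; rewrite /= /sqn y0; ring.
pose s := (u *m pairing y) 0 0.
have -> : u *m (pairing y *m a - 1%:M)
    = (2%:R / sqn y * s) *: row_of_quat y - u.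
  rewrite mulmxBr mulmx1 mulmxA [u *m _]mx11_scalar mul_scalar_mx scalerA.
  by rewrite mulrC.
rewrite quat_of_rowB row_of_quatK; last first.
  by apply: quat_eq; rewrite /= ?y0 ?addr0 ?subrr.
apply: (mulrI yu); rewrite mulrBr -scalerAr yy mulrA mulrA mulrV // mul1r.
rewrite scalerN scalerA mulrAC divfK //.
by rewrite /s mxE sum3 !mxE /=; apply: quat_eq => /=; rewrite y0; ring.
Qed.

Definition mirror (y : quat) : {mpoly rat[3]} := linform (pairing y).

(** The three forms on the right are the coordinates of x1 b1 + x2 b2 + x3 b3 on i, j, ij. *)
Lemma mirrorE b c d : mirror (Quat 0 b c d) =
  b *: (- 'X_i1 + 'X_i2 + 'X_i3) + c *: ('X_i1 - 'X_i2 + 'X_i3)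
  + d *: ('X_i1 + 'X_i2 - 'X_i3).
Proof.
rewrite /mirror /linform sum3 !mxE /= !scalerDr !scalerDl !scalerN !scaleNr.
by ring.
Qed.

Lemma meval_linform c (x : 'rV[rat]_3) : (linform c).@[x 0] = (x *m c) 0 0.
Proof.
rewrite mxE raddf_sum; apply: eq_bigr => i _ /=.
by rewrite mevalZ mevalXU mulrC.
Qed.

(** Adds one linear factor to a divisor g already found. The point on the mirror where g does not
    vanish certifies that [mirror y] is coprime to g. *)
Lemma divides_mirror {y : quat} {f g : {mpoly rat[3]}} (x1 x2 x3 : rat) :
    q0 y = 0 -> y != 0 -> psubst f (- F y) = - f ->
    let x := \row_k nth 0 [:: x1; x2; x3] k : 'rV[rat]_3 in
    (mirror y).@[x 0] = 0 -> g.@[x 0] != 0 -> divides g f ->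
  divides (mirror y * g) f.
Proof.
move=> y0 uy fy x yx gx gf.
apply: (@divides_reflection _ ((2%:R / sqn y) *: row_of_quat y)) gf _.
- rewrite -scalemxAl row_of_quat_pairing // scale_scalar_mx divfK //.
  exact: sqn_unit.
- by rewrite opp_half_turn in fy.
- exists x => //; apply/matrixP => k j.
  by rewrite !ord1 [RHS]mxE -yx meval_linform.
Qed.

(** * Sign changes coming from [Gamma] and from norm 2 *)

Lemma TT2_transversal : Defs.is_transversal [:: F (1 + qi)].
Proof.
split=> //; first by move=> g; rewrite inE => /eqP ->; exact: TT2_1qi.
move=> h /TT2_coset hh; exists (F (1 + qi)); split; first by rewrite inE.
by move=> g []; rewrite inE => /eqP ->.
Qed.

Lemma psubst_opp_Gamma {l f M} :
  odd l -> HGamma l f -> Gamma M -> psubst f (- M) = - f.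
Proof.
move=> ol [[hf _] fG] GM.
by rewrite (psubst_opp _ hf) fG // -signr_odd ol scaleN1r.
Qed.

Lemma psubst_opp_TT2 {l f M} : HGamma_minus l f -> TT2 M -> psubst f (- M) = - f.
Proof.
move=> [[[hf _] fG] fT] /TT2_coset [d Gd ->].
rewrite (psubst_opp _ hf) -psubst_mul.
have sq : ((- 1) ^+ l * (- 1) ^+ l = 1 :> rat) by rewrite -expr2 sqrr_sign.
(* With the single representative F(1 + i), T_2 substitutes its inverse; substituting F(1 + i) back
   inverts the eigenvalue, which is a sign and so its own inverse. *)
have e : psubst f (F (1 + qi)) = (- (- 1) ^+ l) *: f.
  move: fT; rewrite (T2E TT2_transversal fG) /T2sum big_seq1.
  move/(congr1 (fun p => psubst p (F (1 + qi)))).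
  rewrite psubst_mul mulmxV ?F_unit ?unit_1qi // psubst1 /psubst comp_mpolyZ.
  by move=> {2}->; rewrite scalerA mulrNN sq scale1r.
rewrite e {1}/psubst comp_mpolyZ -/(psubst f d) fG // scalerA mulrN sq.
by rewrite scaleN1r.
Qed.

Lemma hurwitz_int (a b c d : int) :
  hurwitz (Quat a%:~R b%:~R c%:~R d%:~R).
Proof.
(* From ij = 2w - 1 - i - j. *)
apply/hurwitzP; exists (a - d), (b - d), (c - d), (d + d).
by split; rewrite /= !(rmorphD, rmorphN) /=; field.
Qed.

Lemma Gamma_int (a b c d : int) :
  a ^+ 2 + b ^+ 2 + c ^+ 2 + d ^+ 2 = 1 ->
  Gamma (F (Quat a%:~R b%:~R c%:~R d%:~R)).
Proof.
move=> h; set y := Quat _ _ _ _.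
have ny : sqn y = 1 by rewrite /sqn /= -!rmorphXn -!rmorphD h.
have yV : y^-1 = Quat a%:~R (- b)%:~R (- c)%:~R (- d)%:~R.
  by rewrite {1}/GRing.inv /= /quat_inv ny invr1 scale1r /qconj /= !rmorphN.
exists y => //; split; [|exact: hurwitz_int|by rewrite yV; exact: hurwitz_int].
by rewrite unfold_in /=; apply: contra_eqN ny => /eqP ->.
Qed.

Lemma TT2_int (a b c d : int) :
  a ^+ 2 + b ^+ 2 + c ^+ 2 + d ^+ 2 = 2 ->
  TT2 (F (Quat a%:~R b%:~R c%:~R d%:~R)).
Proof.
move=> h; exists (Quat a%:~R b%:~R c%:~R d%:~R); split=> //.
  exact: hurwitz_int.
rewrite NmE /sqn /= -!rmorphXn -!rmorphD h.
by rewrite scaler_nat.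
Qed.

Lemma meval_mirror b c d x1 x2 x3 :
  (mirror (Quat 0 b c d)).@[(\row_k nth 0 [:: x1; x2; x3] k : 'rV[rat]_3) 0]
    = b * (- x1 + x2 + x3) + c * (x1 - x2 + x3) + d * (x1 + x2 - x3).
Proof. by rewrite mirrorE !(mevalD, mevalN, mevalZ, mevalXU) !mxE. Qed.

Theorem proposition7 :
  (forall (l : nat) (f : {mpoly rat[3]}),
     odd l -> HGamma l f -> divides f3plus f) /\
  (forall (l : nat) (f : {mpoly rat[3]}),
     HGamma_minus l f -> divides f6minus f).
Proof.
have d1 (f : {mpoly rat[3]}) : divides 1 f by exists f; rewrite mulr1.
split=> l f.
  move=> ol fG.
  have fy b c d h := psubst_opp_Gamma ol fG (@Gamma_int 0 b c d h).
  have : divides (mirror (Quat 0 0 0 1) * (mirror (Quat 0 0 1 0) *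
      (mirror (Quat 0 1 0 0) * 1))) f.
    (* Each triple is a point on the mirror being added and off all the mirrors to its right in the
       product. *)
    apply: (divides_mirror 1 1 2 _ _ (fy 0 0 1 _));
      rewrite ?mevalM ?meval1 ?meval_mirror //.
    apply: (divides_mirror 1 2 1 _ _ (fy 0 1 0 _));
      rewrite ?mevalM ?meval1 ?meval_mirror //.
    by apply: (divides_mirror 2 1 1 _ _ (fy 1 0 0 _));
      rewrite ?meval1 ?meval_mirror.
  move/(@divides_scale (-1) _ _ isT); congr divides.
  by rewrite !mirrorE !(scale0r, scale1r, scaleN1r) /f3plus; ring.
move=> fG; have fy b c d h := psubst_opp_TT2 fG (@TT2_int 0 b c d h).
have : divides (mirror (Quat 0 0 1 1) * (mirror (Quat 0 0 1 (-1)) *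
    (mirror (Quat 0 1 0 1) * (mirror (Quat 0 1 0 (-1)) *
    (mirror (Quat 0 1 1 0) * (mirror (Quat 0 1 (-1) 0) * 1)))))) f.
  apply: (divides_mirror 0 (-1) 1 _ _ (fy 0 1 1 _));
      rewrite ?mevalM ?meval1 ?meval_mirror //.
  apply: (divides_mirror 2 1 1 _ _ (fy 0 1 (-1) _));
      rewrite ?mevalM ?meval1 ?meval_mirror //.
  apply: (divides_mirror (-1) 0 1 _ _ (fy 1 0 1 _));
      rewrite ?mevalM ?meval1 ?meval_mirror //.
  apply: (divides_mirror 1 2 1 _ _ (fy 1 0 (-1) _));
      rewrite ?mevalM ?meval1 ?meval_mirror //.
  apply: (divides_mirror (-1) 1 0 _ _ (fy 1 1 0 _));
      rewrite ?mevalM ?meval1 ?meval_mirror //.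
  by apply: (divides_mirror 1 1 2 _ _ (fy 1 (-1) 0 _));
      rewrite ?meval1 ?meval_mirror.
(* Each of the six mirrors is twice a factor of [f6minus] up to sign; two signs are negative and
   cancel, leaving 2^6. *)
move/(@divides_scale 64%:R^-1 _ _ isT); congr divides.
set p := (X in _ *: X).
have -> : p = 64 *: f6minus.
  rewrite /p !mirrorE !(scale0r, scale1r, scaleN1r) scaler_nat /f6minus; ring.
by rewrite scalerA mulVf ?scale1r.
Qed.
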